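(* Let $q=p^m$ be an odd prime power ($p$ prime). Assume that $m$ is even and $r=p^s$ with $s$ a positive integer such that $s\mid\frac{m}{2}$. Let $n=2tr^{\ell}$, where $\ell,t$ are integers with $0\le\ell<\frac{m}{s}$ and $1\le t\le\frac{r-1}{2}$. Then there exists a $q$-ary NMDS self-dual code of length $n$.
   Context: A $q$-ary $[n,k,d]$-linear code is a subspace $\mathcal C$ of $\mathbb F_q^n$ (with $\mathbb F_q$ the finite field of $q$ elements) of dimension $k$ and minimum (Hamming) distance $d$; $n$ is its length. Its dual is $\mathcal C^{\bot}=\{b\in\mathbb F_q^n : \sum_{i=1}^n a_ib_i=0 \text{ for all } a\in\mathcal C\}$; $\mathcal C$ is self-dual if $\mathcal C=\mathcal C^{\bot}$. An $[n,k,d]$-linear code is AMDS if $d=n-k$. An AMDS code $\mathcal C$ is NMDS if $\mathcal C^{\bot}$ is also AMDS.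
   Formalization: The case t = 1, ℓ = 0 (n = 2) is excluded: there the claim is false, since a self-dual code of length 2 is spanned by a vector with two nonzero entries, so d = 2 ≠ n − k = 1 and it is not AMDS. *)

(* Defs.v *)
From HB Require Import structures.
From mathcomp Require Import all_boot all_order all_algebra all_field.

Set Implicit Arguments.
Unset Strict Implicit.
Unset Printing Implicit Defensive.

Import GRing.Theory.
Local Open Scope ring_scope.

Section Codes.
Variables (F : finFieldType) (n : nat).
Implicit Types (C : {vspace 'rV[F]_n}) (x y a b : 'rV[F]_n).

Definition hamming_dist x y : nat := #|[set i | x 0 i != y 0 i]|.

(* A relation rather than a function: the zero code has no minimum distance. *)
Definition is_min_dist C (d : nat) : Prop :=
  (exists x y, [/\ x \in C, y \in C, x != y & hamming_dist x y = d]) /\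
  (forall x y, x \in C -> y \in C -> x != y -> (d <= hamming_dist x y)%N).

Definition is_linear_code C (k d : nat) : Prop := \dim C = k /\ is_min_dist C d.

Definition dotv a b : F := \sum_(i < n) a 0 i * b 0 i.

Definition dual_set C : {set 'rV[F]_n} :=
  [set b | [forall a, (a \in C) ==> (dotv a b == 0)]].

(* The span only packages the orthogonal set as a {vspace _}; by mem_dual_code
   it adds no vectors. *)
Definition dual_code C : {vspace 'rV[F]_n} := <<enum (dual_set C)>>%VS.

Lemma mem_dual_code C b :
  b \in dual_code C <-> (forall a, a \in C -> dotv a b = 0).
Proof.
split=> [bC a aC | bC]; last first.
  apply: memv_span; rewrite mem_enum inE.
  by apply/forallP=> a; apply/implyP=> /bC->.
rewrite (coord_span bC) /dotv.
under eq_bigr => i _ do rewrite summxE mulr_sumr.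
rewrite exchange_big big1 //= => j _.
have : (enum (dual_set C))`_j \in enum (dual_set C).
  by apply: mem_nth; rewrite -cardE.
rewrite mem_enum inE => /forallP/(_ a)/implyP/(_ aC)/eqP Xj0.
under eq_bigr => i _ do rewrite mxE mulrCA.
by rewrite -mulr_sumr [X in _ * X]Xj0 mulr0.
Qed.

Definition self_dual C : Prop := C = dual_code C.

Definition AMDS C : Prop :=
  exists k d : nat, is_linear_code C k d /\ d = (n - k)%N.

Definition NMDS C : Prop := AMDS C /\ AMDS (dual_code C).

End Codes.

(* A nonzero self-orthogonal vector of length 2 has no zero entry, so a
   self-dual code of length 2 has parameters [2,1,2] and is MDS.  This is why
   the length 2 has to be excluded in existence results for NMDS self-dual
   codes. *)
Lemma self_dual_length2_not_AMDS (F : finFieldType) (C : {vspace 'rV[F]_2}) :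
  self_dual C -> ~ AMDS C.
Proof.
move=> sdC [k [d [[dimC [[x [y [xC yC xy dxy]]] _]] dE]]].
have zC : x - y \in C by rewrite rpredB.
have z0 : x - y != 0 by rewrite subr_eq0.
have k_gt0 : (0 < k)%N.
  rewrite -dimC lt0n dimv_eq0; apply: contraNneq z0 => C0.
  by move: zC; rewrite C0 memv0.
have : dotv (x - y) (x - y) = 0.
  by apply: (iffLR (mem_dual_code C (x - y))) => //; rewrite -sdC.
rewrite /dotv !big_ord_recl big_ord0 addr0.
set j : 'I_2 := lift _ _ => zz.
have zE : forall i : 'I_2, i = 0 \/ i = j.
  by case=> [[|[|i]] ilt] //; [left | right]; apply: val_inj.
have key : (x - y) 0 0 != 0 /\ (x - y) 0 j != 0.
  apply/andP; rewrite -negb_or; apply: contra z0 => z_eq0.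
  have /andP[/eqP a0 /eqP b0] : ((x - y) 0 0 == 0) && ((x - y) 0 j == 0).
    case/orP: z_eq0 => /eqP e0; move/eqP: zz;
      by rewrite e0 mul0r ?addr0 ?add0r mulf_eq0 orbb => ->; rewrite eqxx.
  by apply/eqP/rowP=> i; rewrite [RHS]mxE; case: (zE i) => ->.
have d2 : d = 2.
  rewrite -dxy /hamming_dist -[RHS](card_ord 2) -cardsT; congr #|pred_of_set _|.
  apply/setP=> i; rewrite !inE -subr_eq0.
  by case: key; rewrite !mxE => ? ?; case: (zE i) => ->.
by move: dE; rewrite d2; case: (k) k_gt0 => // -[|[|?]].
Qed.

(* Main.v *)
Require Import Defs.
From mathcomp Require Import all_boot all_order all_algebra all_field.
From mathcomp Require Import cyclic ring zify.

(* Let K = F_r inside F = F_q, H an F_r-subspace of F of size r ^ l, b outside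
   H, A a symmetric set of 2t nonzero elements of K, and let the evaluation
   points be S = H + A b, so |S| = n = 2k.  The code consists of the vectors
   (w_x f(x)), x in S, for the polynomials f of degree at most k without a term
   of degree k - 1.  Such an f has at most k zeros, so the distance is at least
   k, with equality once some k-subset of S has sum 0.  In a product of two such
   polynomials the degree n - 1 does not occur, so Lagrange interpolation on S,
   whose sum is 0, makes the code self-dual provided that
   w_x ^ 2 * \prod_(y != x) (x - y) does not depend on x.  These products are a
   constant times powers of elements of K, which are squares because (q - 1) /
   (r - 1) is even.
   A union of t cosets a b + H has sum |H| b \sum a; this vanishes for l > 0,
   and for l = 0 the set A is chosen to have a t-subset of sum 0. *)

Set Implicit Arguments.
Unset Strict Implicit.
Unset Printing Implicit Defensive.

Import GRing.Theory.
Local Open Scope ring_scope.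

(** * Node polynomials and Lagrange interpolation *)

Definition node_poly (F : finFieldType) (T : {set F}) : {poly F} :=
  \prod_(y in T) ('X - y%:P).

Lemma size_node_poly (F : finFieldType) (T : {set F}) :
  size (node_poly T) = #|T|.+1.
Proof. by rewrite /node_poly -big_enum size_prod_XsubC -cardE. Qed.

Lemma monic_node_poly (F : finFieldType) (T : {set F}) : node_poly T \is monic.
Proof. exact: monic_prod_XsubC. Qed.

Lemma horner_node_poly (F : finFieldType) (T : {set F}) x :
  (node_poly T).[x] = \prod_(y in T) (x - y).
Proof.
by rewrite /node_poly horner_prod; apply: eq_bigr => y _; rewrite hornerXsubC.
Qed.

Lemma node_poly_eq0 (F : finFieldType) (T : {set F}) x :
  ((node_poly T).[x] == 0) = (x \in T).
Proof.
by rewrite /node_poly -big_enum -[RHS]mem_enum; exact: root_prod_XsubC.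
Qed.

Lemma node_poly_subleading (F : finFieldType) (T : {set F}) k :
  #|T| = k.+1 -> (node_poly T)`_k = - \sum_(y in T) y.
Proof.
rewrite /node_poly -!big_enum /= cardE => sT.
by rewrite -coefPn_prod_XsubC sT.
Qed.

(* The left-hand side is the top coefficient of the Lagrange interpolant of
   [Q] on [S]. *)
Lemma lagrange_top_coef (F : finFieldType) (S : {set F}) (Q : {poly F}) k :
  #|S| = k.+1 -> (size Q <= k.+1)%N ->
  \sum_(x in S) Q.[x] / (node_poly (S :\ x)).[x] = Q`_k.
Proof.
move=> cS sQ.
pose L :=
  \sum_(x in S) (Q.[x] / (node_poly (S :\ x)).[x]) *: node_poly (S :\ x).
have sN x : x \in S -> size (node_poly (S :\ x)) = k.+1.
  by move=> xS; rewrite size_node_poly -cS (cardsD1 x S) xS.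
suff /polyP/(_ k) <- : L = Q.
  rewrite coef_sum; apply: eq_bigr => x xS; rewrite coefZ.
  have /monicP := monic_node_poly (S :\ x).
  by rewrite lead_coefE sN // => ->; rewrite mulr1.
have sL : (size L <= k.+1)%N.
  apply: leq_trans (size_sum _ _ _) _; apply/bigmax_leqP => x xS.
  by rewrite (leq_trans (size_scale_leq _ _)) ?sN.
(* Both polynomials have degree at most [k] and they agree at the [k.+1] nodes. *)
apply/eqP; rewrite -subr_eq0; apply: contraT => LQ0.
have: (size (enum S) < size (L - Q)%R)%N.
  apply: max_poly_roots LQ0 _ (enum_uniq _).
  apply/allP => x; rewrite mem_enum => xS.
  rewrite rootE hornerD hornerN subr_eq0 horner_sum (bigD1 x) //=.
  rewrite big1 ?addr0 => [|y /andP[yS yx]].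
    by rewrite hornerZ divfK // node_poly_eq0 !inE eqxx.
  apply/eqP; rewrite hornerZ mulf_eq0 node_poly_eq0 !inE xS andbT (eq_sym x) yx.
  by rewrite orbT.
rewrite -cardE cS ltnNge; apply: contraNT => _.
by rewrite (leq_trans (size_polyD _ _)) // geq_max sL size_polyN.
Qed.

(** The degree may exceed the interpolation range by one: subtracting a multiple of [node_poly S]
    removes the top term without changing values on [S]. It also leaves coefficient [k] alone, since
    that of [node_poly S] is minus the sum of [S]. *)
Lemma lagrange_sum_eq0 (F : finFieldType) (S : {set F}) (Q : {poly F}) k :
  #|S| = k.+1 -> \sum_(x in S) x = 0 -> (size Q <= k.+2)%N -> Q`_k = 0 ->
  \sum_(x in S) Q.[x] / (node_poly (S :\ x)).[x] = 0.
Proof.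
move=> cS S0 sQ Qk.
pose Q' := Q - Q`_k.+1 *: node_poly S.
have -> : \sum_(x in S) Q.[x] / (node_poly (S :\ x)).[x] =
          \sum_(x in S) Q'.[x] / (node_poly (S :\ x)).[x].
  apply: eq_bigr => x xS; congr (_ / _).
  have /eqP Nx0 : (node_poly S).[x] == 0 by rewrite node_poly_eq0.
  by rewrite hornerD hornerN hornerZ Nx0 mulr0 subr0.
rewrite (lagrange_top_coef cS).
  by rewrite coefB coefZ Qk (node_poly_subleading cS) S0 oppr0 mulr0 subr0.
apply/leq_sizeP => j kj; rewrite coefB coefZ.
have [->|jk] := eqVneq j k.+1.
  have /monicP := monic_node_poly S.
  by rewrite lead_coefE size_node_poly cS /= => ->; rewrite mulr1 subrr.
have kj' : (k.+2 <= j)%N by rewrite ltn_neqAle eq_sym jk.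
rewrite (nth_default 0 (leq_trans sQ kj')) (nth_default 0 (s := node_poly S)).
  by rewrite mulr0 subrr.
by rewrite size_node_poly cS.
Qed.

(** * Row spaces and their duals *)

Lemma dotvE (F : finFieldType) n (a b : 'rV[F]_n) :
  dotv a b = (a *m b^T) 0 0.
Proof. by rewrite mxE; apply: eq_bigr => i _; rewrite mxE. Qed.

Lemma mulmx_trmx_dual (F : finFieldType) n k (G : 'M[F]_(k, n)) b :
  (b \in dual_code (limg (linfun (mulmxr G)))) = (b *m G^T == 0).
Proof.
have GbE : G *m b^T = (b *m G^T)^T by rewrite trmx_mul trmxK.
apply/idP/eqP => [/mem_dual_code bG | bG]; last first.
  apply/mem_dual_code => _ /memv_imgP[c _ ->].
  by rewrite lfunE /= dotvE -mulmxA GbE bG trmx0 mulmx0 mxE.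
apply: trmx_inj; rewrite -GbE trmx0.
apply/matrixP => i j; rewrite (ord1 j) [RHS]mxE.
have := bG _ (memv_img (linfun (mulmxr G)) (memvf (delta_mx 0 i))).
by rewrite lfunE /= dotvE -mulmxA -rowE mxE.
Qed.

Lemma dim_row_space (F : finFieldType) n k (G : 'M[F]_(k, n)) :
  row_free G -> \dim (limg (linfun (mulmxr G)) : {vspace 'rV[F]_n}) = k.
Proof.
move=> fG; rewrite limg_dim_eq ?dimvf ?dim_matrix; first by rewrite mul1r.
rewrite capfv; apply/eqP/lker0P => x y; rewrite !lfunE; exact: row_free_injr.
Qed.

(** [G *m G^T = 0] puts the code inside its dual, the kernel of [mulmxr G^T]. By rank-nullity this
    kernel has dimension [n - k = k], so the inclusion is an equality. *)
Lemma self_dual_row_space (F : finFieldType) n k (G : 'M[F]_(k, n)) :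
  row_free G -> G *m G^T = 0 -> n = k.*2 ->
  self_dual (limg (linfun (mulmxr G))).
Proof.
move=> fG GG0 nE; rewrite /self_dual.
pose H := lker (linfun (mulmxr G^T) : 'Hom('rV[F]_n, 'rV[F]_k)).
have -> : dual_code (limg (linfun (mulmxr G))) = H.
  by apply/vspaceP => b; rewrite mulmx_trmx_dual memv_ker lfunE.
apply/eqP; rewrite eqEdim dim_row_space //; apply/andP; split.
  apply/subvP => _ /memv_imgP[c _ ->].
  by rewrite memv_ker !lfunE /= -mulmxA GG0 mulmx0.
have := limg_ker_dim (linfun (mulmxr G^T) : 'Hom('rV[F]_n, 'rV[F]_k)) fullv.
rewrite capfv dimvf dim_matrix mul1r.
have -> : limg (linfun (mulmxr G^T) : 'Hom('rV[F]_n, 'rV[F]_k)) = fullv.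
  have /row_fullP[B BG] : row_full G^T by rewrite /row_full mxrank_tr.
  apply/vspaceP => c; rewrite memvf; apply/memv_imgP.
  by exists (c *m B); rewrite ?memvf // lfunE /= -mulmxA BG mulmx1.
by rewrite dimvf dim_matrix mul1r -/H => dH; rewrite -(leq_add2r k) dH nE addnn.
Qed.

(** * Codes from polynomials with a missing degree *)

Section GapCode.
Variables (F : finFieldType) (n k : nat) (S : {set F}) (w : F -> F).
Hypotheses (nE : n = k.+1.*2) (cS : #|S| = n).

Let pt (i : 'I_n) : F := nth 0 (enum S) i.

Lemma big_nodes (R : Type) (idx : R) (op : Monoid.com_law idx) (g : F -> R) :
  \big[op/idx]_(i < n) g (pt i) = \big[op/idx]_(x in S) g x.
Proof.
by rewrite -[RHS]big_enum [RHS](big_nth 0) -cardE cS big_mkord.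
Qed.

Lemma node_mem i : pt i \in S.
Proof. by rewrite -mem_enum mem_nth // -cardE cS. Qed.

(* [bump k] enumerates the exponents 0, ..., k-1, k+1. *)
Definition gap_poly (c : 'rV[F]_k.+1) : {poly F} :=
  \sum_j c 0 j *: 'X^(bump k j).

(** A Vandermonde matrix with scaled columns and one exponent skipped. With [k.+1] rows, this [k] is
    one less than half the length. *)
Definition gap_gen_mx : 'M[F]_(k.+1, n) :=
  \matrix_(j, i) (w (pt i) * pt i ^+ bump k j).

Lemma gap_encodeE c i :
  (c *m gap_gen_mx) 0 i = w (pt i) * (gap_poly c).[pt i].
Proof.
rewrite mxE horner_sum mulr_sumr; apply: eq_bigr => j _.
by rewrite mxE hornerZ hornerXn mulrCA.
Qed.

Lemma bump_le (j : 'I_k.+1) : (bump k j <= k.+1)%N.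
Proof. by rewrite /bump; have := ltn_ord j; lia. Qed.

Lemma coef_gap_poly c i :
  (gap_poly c)`_i = \sum_j c 0 j * (i == bump k j)%:R.
Proof. by rewrite coef_sum; apply: eq_bigr => j _; rewrite coefZ coefXn. Qed.

Lemma coef_gap_poly_bump c (j : 'I_k.+1) : (gap_poly c)`_(bump k j) = c 0 j.
Proof.
rewrite coef_gap_poly (bigD1 j) //= eqxx mulr1 big1 ?addr0 // => i ij.
rewrite (inj_eq (can_inj (bumpK k))) (inj_eq val_inj) eq_sym (negPf ij).
exact: mulr0.
Qed.

Lemma size_gap_poly c : (size (gap_poly c) <= k.+2)%N.
Proof.
apply: leq_trans (size_sum _ _ _) _; apply/bigmax_leqP => j _.
by rewrite (leq_trans (size_scale_leq _ _)) // size_polyXn ltnS bump_le.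
Qed.

Lemma gap_poly_neq0 c : c != 0 -> gap_poly c != 0.
Proof.
apply: contraNneq => c0; apply/eqP/rowP => j.
by rewrite -coef_gap_poly_bump c0 coef0 mxE.
Qed.

Lemma gap_polyK (f : {poly F}) :
  (size f <= k.+2)%N -> f`_k = 0 -> gap_poly (\row_j f`_(bump k j)) = f.
Proof.
move=> sf fk; apply/polyP => i.
have [->|ik] := eqVneq i k.
  rewrite coef_gap_poly fk big1 // => j _.
  by rewrite (negPf (neq_bump _ _)) mulr0.
have [ik2|ik2] := leqP k.+2 i.
  rewrite (nth_default _ (leq_trans (size_gap_poly _) ik2)).
  by rewrite (nth_default _ (leq_trans sf ik2)).
have jP : (unbump k i < k.+1)%N by rewrite /unbump; lia.
have -> : i = bump k (Ordinal jP) by rewrite /= unbumpK.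
by rewrite coef_gap_poly_bump mxE.
Qed.

Hypothesis w_neq0 : forall x, x \in S -> w x != 0.

Lemma gap_weight c :
  #|[set i | (c *m gap_gen_mx) 0 i != 0]| =
  (n - #|[set x in S | root (gap_poly c) x]|)%N.
Proof.
have -> : #|[set i | (c *m gap_gen_mx) 0 i != 0]| =
    #|[set x in S | ~~ root (gap_poly c) x]|.
  rewrite -!sum1_card (eq_bigl (fun i => ~~ root (gap_poly c) (pt i))).
    rewrite big_mkcond.
    rewrite (big_nodes addn
      (fun x => if ~~ root (gap_poly c) x then 1 else 0)%N).
    by rewrite -big_mkcondr; apply: eq_bigl => x; rewrite inE.
  by move=> i; rewrite inE gap_encodeE mulf_eq0 negb_or w_neq0 ?node_mem.
rewrite -cS -(cardsID [set x | root (gap_poly c) x] S).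
have -> : [set x in S | root (gap_poly c) x] =
    S :&: [set x | root (gap_poly c) x].
  by apply/setP => x; rewrite !inE.
rewrite addKn; apply: eq_card => x.
by rewrite !inE andbC.
Qed.

(** A nonzero gap polynomial has degree at most [k.+1], so at most half of the [k.+1.*2] nodes are
    roots. *)
Lemma gap_weight_ge (c : 'rV[F]_k.+1) :
  c != 0 -> (k.+1 <= #|[set i | (c *m gap_gen_mx) 0%R i != 0%R]|)%N.
Proof.
move=> c0; rewrite gap_weight nE.
suff : (#|[set x in S | root (gap_poly c) x]| < k.+2)%N by lia.
rewrite cardE; apply: leq_trans (size_gap_poly c).
apply: max_poly_roots (gap_poly_neq0 c0) _ (enum_uniq _).
by apply/allP => x; rewrite mem_enum inE => /andP[].
Qed.

(** A nonzero message has positive weight, so encoding is injective. *)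
Lemma gap_gen_mx_free : row_free gap_gen_mx.
Proof.
apply: inj_row_free => c cG; apply: contraTeq isT => /gap_weight_ge.
rewrite cG [X in #|pred_of_set X|](_ : _ = set0) ?cards0 //.
by apply/setP => i; rewrite !inE mxE eqxx.
Qed.

Lemma hamming_dist_mulmx (c d : 'rV[F]_k.+1) :
  hamming_dist (c *m gap_gen_mx) (d *m gap_gen_mx) =
  #|[set i | ((c - d) *m gap_gen_mx) 0 i != 0]|.
Proof.
apply: eq_card => i; rewrite !inE mulmxBl.
by rewrite !mxE subr_eq0.
Qed.

Variables (lam : F) (I : {set F}).
Hypotheses (lam_neq0 : lam != 0) (S_sum : \sum_(x in S) x = 0).
Hypothesis wE : forall x, x \in S -> w x ^+ 2 = lam / (node_poly (S :\ x)).[x].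
Hypotheses (IS : I \subset S) (cI : #|I| = k.+1) (I_sum : \sum_(x in I) x = 0).

(** Each entry is [lam] times the Lagrange sum of a monomial of degree at most [n] and different
    from [n - 1]. *)
Lemma gap_gen_mx_orthogonal : gap_gen_mx *m gap_gen_mx^T = 0.
Proof.
apply/matrixP => i j; rewrite !mxE.
under eq_bigr => h _ do rewrite !mxE mulrACA -exprD -expr2.
rewrite (big_nodes +%R (fun x => w x ^+ 2 * x ^+ (bump k i + bump k j))).
under eq_bigr => x xS do rewrite (wE xS) mulrAC -mulrA -hornerXn.
rewrite -mulr_sumr (lagrange_sum_eq0 (k := k.*2.+1)) ?mulr0 //.
- by rewrite cS nE doubleS.
- by rewrite size_polyXn; have := bump_le i; have := bump_le j; lia.
(* Exponents are at most [k.+1], so a sum of [k.*2.+1] would need the skipped exponent [k]. *)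
rewrite coefXn; case: eqP => // e.
by have := neq_bump k i; have := neq_bump k j; have := bump_le i;
  have := bump_le j; lia.
Qed.

Lemma gap_code_NMDS : exists C : {vspace 'rV[F]_n}, self_dual C /\ NMDS C.
Proof.
exists (limg (linfun (mulmxr gap_gen_mx))).
have sd := self_dual_row_space gap_gen_mx_free gap_gen_mx_orthogonal nE.
split=> //; suff: AMDS (limg (linfun (mulmxr gap_gen_mx))).
  by move=> am; split; rewrite // -sd.
exists k.+1, k.+1; split; last by rewrite nE; lia.
split; first exact: dim_row_space gap_gen_mx_free.
split=> [|_ _ /memv_imgP[c _ ->] /memv_imgP[d _ ->]]; last first.
  rewrite !lfunE /= hamming_dist_mulmx => cd; apply: gap_weight_ge.
  by apply: contraNneq cd => /subr0_eq->.
(* The word of minimum weight comes from the node polynomial of [I]: its coefficient at [k] is minus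
   the sum of [I], hence 0, and its roots are exactly the [k.+1] elements of [I]. *)
pose c : 'rV[F]_k.+1 := \row_j (node_poly I)`_(bump k j).
have cE : gap_poly c = node_poly I.
  rewrite gap_polyK ?size_node_poly ?cI //.
  by rewrite (node_poly_subleading cI) I_sum oppr0.
have wt : hamming_dist (c *m gap_gen_mx) (0 *m gap_gen_mx) = k.+1.
  rewrite hamming_dist_mulmx subr0 gap_weight cE.
  have -> : [set x in S | root (node_poly I) x] = I.
    apply/setP => x; rewrite inE rootE node_poly_eq0 andbC.
    by case: (boolP (x \in I)) => // /(subsetP IS).
  by rewrite cI nE; lia.
exists (c *m gap_gen_mx), (0 *m gap_gen_mx); split=> //.
- by rewrite -[c *m _](lfunE (mulmxr gap_gen_mx)) memv_img ?memvf.
- by rewrite mul0mx mem0v.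
apply/eqP => e; move: wt; rewrite e /hamming_dist.
rewrite [X in #|pred_of_set X|](_ : _ = set0) ?cards0 //.
by apply/setP => i; rewrite !inE eqxx.
Qed.

End GapCode.

(** * The subfield of order r and its squares *)

Lemma finField_prim_root (F : finFieldType) :
  exists z : F, (#|F|.-1).-primitive_root z.
Proof.
have F1 : (0 < #|F|.-1)%N by rewrite -subn1 subn_gt0 finNzRing_gt1.
have/hasP[z _ zP] : has (#|F|.-1).-primitive_root (enum [set~ (0 : F)]).
  apply: has_prim_root; rewrite ?enum_uniq // -?cardE ?cardsC1 //.
  apply/allP => x; rewrite mem_enum in_setC1 => x0; apply/unity_rootP.
  apply: (mulfI x0); rewrite -exprS mulr1 prednK ?expf_card //.
  exact: ltnW (finNzRing_gt1 F).
by exists z.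
Qed.

Section FixedField.
Variables (F : finFieldType) (p s e : nat).
Let r := (p ^ s)%N.
Hypotheses (p_prime : prime p) (p_odd : odd p) (s_gt0 : (0 < s)%N).
Hypotheses (cardF : #|F| = (r ^ e.*2)%N).

Implicit Types (x y : F) (A B : {set F}).

(** The subfield with [r] elements, cut out by a power of the Frobenius map. *)
Definition fixed_field : {set F} := [set x | x ^+ r == x].
Local Notation K := fixed_field.

Lemma fixed_pchar : p \in [pchar F].
Proof. by apply: card_finPcharP p_prime; rewrite cardF -expnM. Qed.

Lemma fixed_exponent_odd : odd r.
Proof. by rewrite oddX p_odd orbT. Qed.

Lemma fixed_exponent_gt2 : (2 < r)%N.
Proof.
rewrite (@leq_trans p) ?odd_prime_gt2 //.
by rewrite -{1}[p]expn1 leq_exp2l ?prime_gt1.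
Qed.

Lemma fixed0 : 0 \in K.
Proof. by rewrite inE expr0n; case: r fixed_exponent_gt2. Qed.

Lemma fixed1 : 1 \in K.
Proof. by rewrite inE expr1n. Qed.

Lemma fixedN x : x \in K -> - x \in K.
Proof.
by rewrite !inE exprNn -signr_odd fixed_exponent_odd mulN1r eqr_opp.
Qed.

Lemma fixedD x y : x \in K -> y \in K -> x + y \in K.
Proof.
rewrite !inE exprDn_pchar => [/eqP-> /eqP->//|].
by rewrite pnatX pnatE // fixed_pchar.
Qed.

Lemma fixedM x y : x \in K -> y \in K -> x * y \in K.
Proof. by rewrite !inE exprMn => /eqP-> /eqP->. Qed.

Lemma fixedV x : x \in K -> x^-1 \in K.
Proof. by rewrite !inE exprVn => /eqP->. Qed.

(* The index of the unit groups is even since [r ^ 2 - 1] divides [q - 1]. *)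
Lemma fixed_prim_root :
  exists z : F, r.-1.-primitive_root (z ^+ 2).
Proof.
have r2 := fixed_exponent_gt2; have rodd := fixed_exponent_odd.
have [z zP] := finField_prim_root F.
pose N := (\sum_(i < e) (r ^ 2) ^ i)%N.
have qE : #|F|.-1 = (r.-1 * r.+1 * N)%N.
  rewrite cardF -mul2n expnM predn_exp; congr (_ * _)%N.
  by rewrite -subn1 -[X in (_ - X)%N](exp1n 2) subn_sqr subn1 addn1.
have q0 : (0 < #|F|.-1)%N by exact: prim_order_gt0 zP.
have := exp_prim_root zP (r.+1 * N)%N.
have -> : (#|F|.-1 %/ gcdn (r.+1 * N) #|F|.-1)%N = r.-1.
  rewrite qE -mulnA gcdnMl mulnK //.
  by move: q0; rewrite qE -mulnA muln_gt0 => /andP[].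
(* As [r] is odd, [r.+1] can be halved; the square of this power has exponent (q - 1) / (r - 1),
   hence order [r.-1]. *)
move=> zr; exists (z ^+ (r.+1./2 * N)).
suff -> : (z ^+ (r.+1./2 * N)) ^+ 2 = z ^+ (r.+1 * N) by [].
rewrite -exprM; congr (_ ^+ _).
by rewrite mulnAC muln2 halfK /= rodd subn0.
Qed.

Lemma fixed_unity x : x != 0 -> (x \in K) = (x ^+ r.-1 == 1).
Proof.
move=> x0; rewrite inE -(prednK (ltnW (ltnW fixed_exponent_gt2))) exprS.
by rewrite -[X in _ == X]mulr1 (inj_eq (mulfI x0)).
Qed.

(** The nonzero elements of [K] are powers of the square [z ^+ 2]. The root lies in [F], not
    necessarily in [K]. *)
Lemma fixed_sqr x : x \in K -> exists y, x = y ^+ 2.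
Proof.
have [-> _|x0] := eqVneq x 0; first by exists 0; rewrite expr0n.
have [z zP] := fixed_prim_root.
rewrite fixed_unity // => /eqP /(prim_rootP zP)[i ->].
by exists (z ^+ i); rewrite -!exprM mulnC.
Qed.

Lemma card_fixed : #|K| = r.
Proof.
have [z zP] := fixed_prim_root.
rewrite (cardsD1 0) fixed0 -[RHS](prednK (ltnW (ltnW fixed_exponent_gt2))).
congr _.+1.
have -> : K :\ 0 = [set (z ^+ 2) ^+ i | i : 'I_r.-1].
  apply/setP => x; rewrite in_setD1; apply/andP/imsetP => [[x0]|[i _ ->]].
    by rewrite fixed_unity // => /eqP /(prim_rootP zP)[i ->]; exists i.
  have zi : (z ^+ 2) ^+ i != 0.
    by rewrite expf_neq0 // (prim_root_eq0 zP) -lt0n (prim_order_gt0 zP).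
  by rewrite fixed_unity // (exprAC (z ^+ 2)) (prim_expr_order zP) expr1n.
rewrite card_imset ?card_ord // => i j /eqP.
by rewrite (eq_prim_root_expr zP) !modn_small // => /eqP/val_inj.
Qed.

(** * Symmetric sets in odd characteristic *)

Lemma fixed_two_neq0 : 2%:R != 0 :> F.
Proof.
rewrite -(dvdn_pcharf fixed_pchar); apply/negP => /dvdn_leq /=.
by have := odd_prime_gt2 p_odd p_prime; lia.
Qed.

Lemma fixed_neqN (x : F) : x != 0 -> x != - x.
Proof.
move=> x0; rewrite -subr_eq0 opprK -mulr2n -mulr_natl mulf_eq0 negb_or x0.
by rewrite fixed_two_neq0.
Qed.

(** Negation permutes [A], so the sum is its own negative, and 2 is nonzero. *)
Lemma sum_symmetric (A : {set F}) :
  {in A, forall x, - x \in A} -> \sum_(x in A) x = 0.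
Proof.
move=> symA; apply: contraTeq isT => /fixed_neqN/eqP[].
rewrite {1}(reindex_inj oppr_inj) /= -sumrN; apply: eq_bigl => x.
by apply/idP/idP => /symA; rewrite ?opprK.
Qed.

Definition add_pair x A := x |: (- x |: A).

Lemma mem_add_pair x A y :
  (y \in add_pair x A) = [|| y == x, y == - x | y \in A].
Proof. by rewrite !inE. Qed.

Lemma add_pair_symmetric x A :
  {in A, forall y, - y \in A} ->
  {in add_pair x A, forall y, - y \in add_pair x A}.
Proof.
move=> symA y; rewrite !mem_add_pair => /or3P[/eqP->|/eqP->|/symA->].
- by rewrite eqxx orbT.
- by rewrite opprK eqxx.
- by rewrite !orbT.
Qed.

Lemma card_add_pair x A : {in A, forall y, - y \in A} -> x != 0 -> x \notin A ->
  #|add_pair x A| = #|A|.+2.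
Proof.
move=> symA x0 xA; rewrite !cardsU1 !inE (negPf (fixed_neqN x0)) (negPf xA).
suff -> : - x \notin A by [].
by apply: contra xA => /symA; rewrite opprK.
Qed.

Lemma add_pair_sub x A : x \in K -> x != 0 -> A \subset K :\ 0 ->
  add_pair x A \subset K :\ 0.
Proof.
move=> xK x0 AK; rewrite !subUset !sub1set AK !in_setD1 oppr_eq0 x0 xK.
by rewrite fixedN.
Qed.

Lemma fixed_pick A : (#|A| < r)%N -> exists2 x, x \in K & x \notin A.
Proof.
move=> Ar; apply/subsetPn; apply: contraL Ar => /subset_leq_card.
by rewrite card_fixed -leqNgt.
Qed.

(** [A] indexes the cosets that form the evaluation set; [B], half of it, indexes those that serve
    as roots of a word of minimum weight. *)
Definition balanced t A B : Prop :=
  [/\ A \subset K :\ 0, {in A, forall x, - x \in A}, #|A| = t.*2,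
      B \subset A & #|B| = t].

(** Two new pairs [x], [- x] and [y], [- y] join [A], but only the first joins [B], whose sum stays
    0. There is room, since 2t + 1 and then 2t + 3 excluded elements are fewer than [r]. *)
Lemma balanced_step t A B : balanced t A B -> \sum_(x in B) x = 0 ->
  (t.+2 <= r.-1./2)%N ->
  exists A' B', balanced t.+2 A' B' /\ \sum_(x in B') x = 0.
Proof.
case=> AK symA cA BA cB B0 tr.
have [x xK] : exists2 x, x \in K & x \notin 0 |: A.
  apply: fixed_pick; rewrite (leq_ltn_trans (leq_card_setU _ _)) //.
  by rewrite cards1 cA; lia.
rewrite in_setU1 negb_or => /andP[x0 xA].
have symx := add_pair_symmetric (x := x) symA.
have cx := card_add_pair symA x0 xA.
have [y yK] : exists2 y, y \in K & y \notin 0 |: add_pair x A.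
  apply: fixed_pick; rewrite (leq_ltn_trans (leq_card_setU _ _)) //.
  by rewrite cards1 cx cA; lia.
rewrite in_setU1 negb_or => /andP[y0 yA].
have xB : x \notin B by apply: contra xA; exact: subsetP.
have NxB : - x \notin B.
  by apply: contra xA => /(subsetP BA)/symA; rewrite opprK.
exists (add_pair y (add_pair x A)), (add_pair x B); split; first split.
- by rewrite !add_pair_sub.
- exact: add_pair_symmetric.
- by rewrite !card_add_pair // cA !doubleS.
- apply/subsetP => z; rewrite !mem_add_pair => /or3P[->|->|/(subsetP BA)->];
    by rewrite ?orbT.
- by rewrite !cardsU1 !inE (negPf (fixed_neqN x0)) xB NxB cB.
by rewrite !big_setU1 ?inE ?(negPf (fixed_neqN x0)) //= B0 addr0 subrr.
Qed.

(** [B] consists of 1, [b] and [- (1 + b)], and [A] is its closure under negation. *)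
Lemma balanced3 : (3 <= r.-1./2)%N ->
  exists A B, balanced 3 A B /\ \sum_(x in B) x = 0.
Proof.
move=> r7; have two := fixed_two_neq0.
(* Excluded are the values for which one of [b], [1 + b] vanishes or two of 1, [b], [1 + b] agree up
   to sign; they number at most five, while [r] is at least 7. *)
have [b bK] : exists2 b, b \in K &
    b \notin 0 |: (1 |: (- 1 |: (- 2%:R |: [set - 2%:R^-1]))).
  by apply: fixed_pick; rewrite !cardsU1 cards1; do !case: (_ \notin _); lia.
rewrite !inE !negb_or => /and5P[b0 b1 bN1 bN2 bNh].
have e1 : 1 != 0 :> F by apply: oner_neq0.
have b2 : 1 + b + b != 0.
  apply: contraNneq bNh => bb0; apply/eqP/(mulIf two).
  by rewrite mulNr mulVf //; apply/eqP; rewrite -addr_eq0 -bb0; apply/eqP; ring.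
have c0 : 1 + b != 0 by rewrite addrC addr_eq0.
have c1 : 1 + b != 1 by rewrite -subr_eq0 (_ : 1 + b - 1 = b) //; ring.
have cN1 : 1 + b != - 1.
  by rewrite -addr_eq0 (_ : 1 + b + 1 = b + 2%:R) ?addr_eq0 //; ring.
have cb : 1 + b != b by rewrite -subr_eq0 addrK.
have cNb : 1 + b != - b by rewrite -addr_eq0.
have sym0 : {in set0, forall y : F, - y \in (set0 : {set F})}.
  by move=> y; rewrite inE.
have sym1 := add_pair_symmetric (x := 1) sym0.
have symb := add_pair_symmetric (x := b) sym1.
have b1A : b \notin add_pair 1 set0 by rewrite !inE !negb_or b1 bN1.
have cA : 1 + b \notin add_pair b (add_pair 1 set0).
  by rewrite !inE !negb_or cb cNb c1 cN1.
have d1 : 1 \notin b |: [set - (1 + b)].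
  by rewrite !inE negb_or (eq_sym 1) b1 eq_sym eqr_oppLR cN1.
have db : b \notin [set - (1 + b)] by rewrite inE eq_sym eqr_oppLR.
exists (add_pair (1 + b) (add_pair b (add_pair 1 set0))),
  (1 |: (b |: [set - (1 + b)])); split; first split.
- by rewrite !add_pair_sub ?fixedD ?fixed1 ?sub0set.
- exact: add_pair_symmetric.
- by rewrite !card_add_pair ?cards0 // inE.
- by apply/subsetP => z; rewrite !inE => /or3P[]->; rewrite ?orbT.
- by rewrite !cardsU1 d1 db cards1.
by rewrite !big_setU1 //= big_set1; ring.
Qed.

(** Steps of 2 from 0 and from 3 reach every [t] except 1, where [B] is a single nonzero element and
    cannot have sum 0. *)
Lemma balanced_exists t : (t <= r.-1./2)%N ->
  exists A B, balanced t A B /\ (t != 1%N -> \sum_(x in B) x = 0).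
Proof.
elim/ltn_ind: t => -[|[|[|[|t]]]] IH tr.
- exists set0, set0; split; last by rewrite big_set0.
  by split; rewrite ?sub0set ?cards0 // => x; rewrite inE.
- have sym0 : {in set0, forall y : F, - y \in (set0 : {set F})}.
    by move=> y; rewrite inE.
  exists (add_pair 1 set0), [set 1]; split=> //; split.
  + by rewrite add_pair_sub ?sub0set ?fixed1 ?oner_neq0.
  + exact: add_pair_symmetric.
  + by rewrite card_add_pair ?cards0 ?oner_neq0 // inE.
  + by rewrite sub1set !inE eqxx.
  + by rewrite cards1.
- have [//|//|A [B [bAB B0]]] := IH 0%N _ _.
  have [A' [B' [? ?]]] := balanced_step bAB (B0 isT) tr.
  by exists A', B'.
- by have [A [B [? ?]]] := balanced3 tr; exists A, B.
- have [||A [B [bAB B0]]] := IH t.+2 _ _; [lia | lia |].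
  have [A' [B' [? ?]]] := balanced_step bAB (B0 isT) tr.
  by exists A', B'.
Qed.

(** * Subspaces over the subfield and unions of cosets *)

Definition fixed_subspace (H : {set F}) : Prop :=
  [/\ 0 \in H, {in H &, forall x y, x + y \in H}
    & {in K & H, forall c x, c * x \in H}].

Lemma fixed_subspaceN H : fixed_subspace H -> {in H, forall x, - x \in H}.
Proof.
by case=> _ _ ZH x xH; rewrite -mulN1r ZH // fixedN // fixed1.
Qed.

Lemma fixed_subspaceB H : fixed_subspace H -> {in H &, forall x y, x - y \in H}.
Proof.
by move=> sH x y xH /(fixed_subspaceN sH) yH; case: sH => _ DH _; exact: DH.
Qed.

Definition cosets (b : F) (H A : {set F}) : {set F} :=
  [set u.1 + u.2 * b | u in setX H A].

Section Cosets.
Variables (b : F) (H : {set F}).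
Hypotheses (sH : fixed_subspace H) (bH : b \notin H).

(** Two representations with [a != a'] give [(a - a') * b] in [H]; dividing by [a - a'], an element
    of [K], would put [b] in [H]. *)
Lemma cosets_inj A : A \subset K ->
  {in setX H A &, injective (fun u : F * F => u.1 + u.2 * b)}.
Proof.
move=> AK [h a] [h' a'] /setXP[/= hH /(subsetP AK) aK].
move=> /setXP[/= h'H /(subsetP AK) a'K] E.
have E' : (a - a') * b = h' - h.
  by apply/eqP; rewrite -subr_eq0; move/eqP: E; rewrite -subr_eq0;
    congr (_ == 0); ring.
have [aa'|aa'] := eqVneq a a'.
  by move: E' => /esym/eqP; rewrite aa' subrr mul0r subr_eq0 => /eqP->.
case/negP: bH; rewrite -(mulKf (x := a - a') _ b) ?subr_eq0 // E'.
case: (sH) => _ _ ZH; rewrite ZH ?fixedV ?fixedD ?fixedN //.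
exact: fixed_subspaceB.
Qed.

Lemma card_cosets A : A \subset K -> #|cosets b H A| = (#|H| * #|A|)%N.
Proof. by move=> /cosets_inj/card_in_imset ->; rewrite cardsX. Qed.

Lemma big_cosets (R : Type) (idx : R) (op : Monoid.com_law idx) A (g : F -> R) :
  A \subset K ->
  \big[op/idx]_(x in cosets b H A) g x =
  \big[op/idx]_(a in A) \big[op/idx]_(h in H) g (h + a * b).
Proof.
move=> AK; rewrite (big_imset _ (cosets_inj AK)) exchange_big pair_big_dep /=.
by apply: eq_bigl => -[h a]; rewrite in_setX.
Qed.

Lemma cosets_fixed_subspace : fixed_subspace (cosets b H K).
Proof.
case: (sH) => H0 DH ZH; split.
- by apply/imsetP; exists (0, 0); rewrite ?in_setX ?H0 ?fixed0 //= mul0r addr0.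
- move=> _ y /imsetP[[h a] /setXP[hH aK] ->].
  move=> /imsetP[[h' a'] /setXP[h'H a'K] ->].
  apply/imsetP; exists (h + h', a + a'); first by rewrite in_setX DH ?fixedD.
  by rewrite /=; ring.
move=> c _ cK /imsetP[[h a] /setXP[hH aK] ->]; apply/imsetP.
exists (c * h, c * a); first by rewrite in_setX ZH ?fixedM.
by rewrite /=; ring.
Qed.

Lemma big_translate (R : Type) (idx : R) (op : Monoid.com_law idx)
    (g : F -> R) h0 : h0 \in H ->
  \big[op/idx]_(h in H) g (h0 - h) = \big[op/idx]_(h in H) g h.
Proof.
move=> h0H; rewrite [RHS](reindex_inj (inj_comp (addrI h0) oppr_inj)) /=.
apply: eq_bigl => h; apply/idP/idP => hH; first exact: fixed_subspaceB.
by rewrite -[h](subKr h0); exact: fixed_subspaceB.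
Qed.

(** Multiplication by [c] permutes [H], and each factor [c * h + c * b] is [c * (h + b)]. *)
Lemma prod_coset c : c \in K -> c != 0 ->
  \prod_(h in H) (h + c * b) = c ^+ #|H| * \prod_(h in H) (h + b).
Proof.
move=> cK c0; rewrite -prodr_const -big_split /=.
rewrite [LHS](reindex_inj (mulfI c0)) /=.
apply: eq_big => [h|h _]; last by rewrite mulrDr.
case: (sH) => _ _ ZH; apply/idP/idP => hH; last exact: ZH.
by rewrite -(mulKf c0 h) ZH ?fixedV.
Qed.

Lemma prod_shift_neq0 c : c \in K -> c != 0 -> \prod_(h in H) (h + c * b) != 0.
Proof.
move=> cK c0; apply/prodf_neq0 => h hH; apply: contra bH.
rewrite addr_eq0 => /eqP hE; case: (sH) => _ _ ZH.
by rewrite -(mulKf c0 b) ZH ?fixedV // -[c * b]opprK -hE (fixed_subspaceN sH).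
Qed.

(* Up to squares this is independent of the node: the nonzero elements of
   [fixed_field] are squares, so the last factor is one. *)
Lemma node_poly_cosets A h0 a0 : A \subset K -> h0 \in H -> a0 \in A ->
  (node_poly (cosets b H A :\ (h0 + a0 * b))).[h0 + a0 * b] =
  (\prod_(h in H :\ 0) h) * (\prod_(h in H) (h + b)) ^+ #|A|.-1 *
  (\prod_(a in A :\ a0) (a0 - a)) ^+ #|H|.
Proof.
move=> AK h0H a0A; rewrite horner_node_poly.
(* Replacing the zero factor at [y = x0] by 1 lets the product run over the whole union and split by
   cosets. *)
pose g (z : F) := if z == 0 then 1 else z.
set x0 := h0 + _.
have -> : \prod_(y in cosets b H A :\ x0) (x0 - y) =
          \prod_(y in cosets b H A) g (x0 - y).
  rewrite (eq_bigl (fun y => (y \in cosets b H A) && (y != x0))) => [|y].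
    rewrite big_mkcondr; apply: eq_bigr => y _.
    by rewrite /g subr_eq0 eq_sym; case: eqP.
  by rewrite !inE andbC.
(* The coset of [a0] gives the product over [H :\ 0]; the others fall under [prod_coset]. *)
rewrite (big_cosets _ _ AK) (bigD1 a0) //= -mulrA; congr (_ * _).
  transitivity (\prod_(h in H) g (h0 - h)).
    by apply: eq_bigr => h _; congr g; rewrite /x0; ring.
  rewrite big_translate // (big_setD1 0) /=; last by case: sH.
  rewrite {1}/g eqxx mul1r; apply: eq_bigr => h.
  by rewrite in_setD1 /g => /andP[/negPf->].
have -> : #|A|.-1 = #|A :\ a0| by rewrite (cardsD1 a0 A) a0A.
rewrite -prodr_const -prodrXl -big_split /=.
apply: eq_big => [a|a /andP[aA aa0]]; first by rewrite in_setD1 andbC.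
have [cK c0] : a0 - a \in K /\ a0 - a != 0.
  by rewrite fixedD ?fixedN ?(subsetP AK) // subr_eq0 eq_sym.
rewrite [RHS]mulrC -prod_coset //.
rewrite -(big_translate _ (fun h => h + (a0 - a) * b) h0H).
apply: eq_bigr => h hH.
have -> : x0 - (h + a * b) = h0 - h + (a0 - a) * b by rewrite /x0; ring.
rewrite /g; case: eqP => // e0.
have /prodf_neq0/(_ (h0 - h)) := prod_shift_neq0 cK c0.
by rewrite e0 eqxx => /(_ (fixed_subspaceB sH h0H hH)).
Qed.

End Cosets.
Lemma fixed_subspace_proper l (H : {set F}) :
  (l < e.*2)%N -> #|H| = (r ^ l)%N -> exists b, b \notin H.
Proof.
move=> le cH; apply/existsP; rewrite -negb_forall.
apply: contraL le => /forallP HT.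
have : #|H| = #|F| by apply: eq_card.
rewrite cH cardF => /eqP; rewrite eqn_exp2l ?(ltnW fixed_exponent_gt2) //.
by move=> /eqP->; rewrite ltnn.
Qed.

(** Each step adjoins a vector [b] outside [H]: [cosets b H K] is the subspace H + K b, [r] times
    larger. *)
Lemma fixed_subspace_exists l : (l <= e.*2)%N ->
  exists H, fixed_subspace H /\ #|H| = (r ^ l)%N.
Proof.
elim: l => [|l IH] le.
  exists [set 0]; split; last by rewrite cards1 expn0.
  split=> [|x y|c x _]; rewrite !inE // => /eqP->; last by rewrite mulr0.
  by move=> /eqP->; rewrite addr0.
have [H [sH cH]] := IH (ltnW le).
have [b bH] := fixed_subspace_proper le cH.
exists (cosets b H K); split; first exact: cosets_fixed_subspace.
by rewrite card_cosets // card_fixed cH expnSr.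
Qed.

Lemma cosets_symmetric b H A : fixed_subspace H ->
  {in A, forall x, - x \in A} ->
  {in cosets b H A, forall x, - x \in cosets b H A}.
Proof.
move=> sH symA _ /imsetP[[h a] /setXP[hH aA] ->]; apply/imsetP.
exists (- h, - a); first by rewrite in_setX symA ?(fixed_subspaceN sH).
by rewrite /=; ring.
Qed.

Lemma fixed_prod_sqr A a0 : A \subset K -> a0 \in K ->
  exists y, \prod_(a in A :\ a0) (a0 - a) = y ^+ 2.
Proof.
move=> AK a0K; apply: fixed_sqr.
apply: (big_ind (fun x => x \in K)) => [|x y|a]; first exact: fixed1.
  exact: fixedM.
by rewrite in_setD1 => /andP[_ /(subsetP AK) aK]; rewrite fixedD ?fixedN.
Qed.

(** * Evaluation set, weights and the resulting code *)

Lemma cosets_NMDS t l n : (0 < t)%N -> (t <= r.-1./2)%N -> (l < e.*2)%N ->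
  n = (2 * t * r ^ l)%N -> (2 < n)%N ->
  exists C : {vspace 'rV[F]_n}, self_dual C /\ NMDS C.
Proof.
move=> t_gt0 tr le nE n_gt2.
have r_gt0 : (0 < r)%N by rewrite (ltnW (ltnW fixed_exponent_gt2)).
have [A [B [[AK0 symA cA BA cB] B0]]] := balanced_exists tr.
have AK : A \subset K by rewrite (subset_trans AK0) ?subsetDl.
have BK := subset_trans BA AK.
have [H [sH cH]] := fixed_subspace_exists (ltnW le).
have [b bH] := fixed_subspace_proper le cH.
pose S := cosets b H A.
have [k kE] : exists k, (t * r ^ l)%N = k.+1.
  by exists (t * r ^ l).-1; rewrite prednK // muln_gt0 t_gt0 expn_gt0 r_gt0.
have nk : n = k.+1.*2 by rewrite nE -mulnA kE mul2n.
have cS : #|S| = n by rewrite card_cosets // cA cH nE -mul2n mulnC.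
have S0 : \sum_(x in S) x = 0.
  exact/sum_symmetric/cosets_symmetric.
have cI : #|cosets b H B| = k.+1 by rewrite card_cosets // cB cH mulnC.
have I0 : \sum_(x in cosets b H B) x = 0.
  rewrite (big_cosets sH bH _ _ BK).
  under eq_bigr => a _ do
    rewrite big_split /= (sum_symmetric (fixed_subspaceN sH)) add0r
      sumr_const cH.
  (* For positive [l] the factor [r ^ l] is 0 in [F]. For [l = 0] the sum of [B] must vanish, which
     holds because [t = 1] would give [n = 2]. *)
  case: l {le kE cH} => [|l] in nE *; last first.
    rewrite big1 // => a _; rewrite -mulr_natl natrX natrX.
    by rewrite (pcharf0 fixed_pchar) expr0n -(prednK s_gt0) expr0n !mul0r.
  rewrite expn0 -mulr_suml B0 ?mul0r //.
  by apply: contraTneq n_gt2 => t1; rewrite nE t1.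
have IS : cosets b H B \subset S.
  apply/subsetP => _ /imsetP[[h a] /setXP[hH /(subsetP BA) aA] ->].
  by apply/imsetP; exists (h, a); rewrite // in_setX hH.
pose lam := (\prod_(h in H :\ 0) h) * (\prod_(h in H) (h + b)) ^+ #|A|.-1.
have lam0 : lam != 0.
  rewrite mulf_neq0 ?expf_neq0 //.
    by apply/prodf_neq0 => h; rewrite in_setD1 => /andP[].
  by have := prod_shift_neq0 sH bH fixed1 (oner_neq0 F); rewrite mul1r.
(* The default 0 is never taken on [S], where the quotient is a square. *)
pose w x := odflt 0 [pick y | y ^+ 2 == lam / (node_poly (S :\ x)).[x]].
have wE x : x \in S -> w x ^+ 2 = lam / (node_poly (S :\ x)).[x].
  move=> /imsetP[[h a] /setXP[/= hH aA] ->]; rewrite /w.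
  case: pickP => [y /eqP //|none].
  have [y yE] := fixed_prod_sqr AK (subsetP AK _ aA).
  (* The node product is [lam * (y ^+ 2) ^+ #|H|], so this inverse is a square root of the
     quotient. *)
  have := none (y ^+ #|H|)^-1; rewrite node_poly_cosets // -/lam yE.
  by rewrite invfM mulrA divff // mul1r exprAC exprVn eqxx.
have w0 x : x \in S -> w x != 0.
  move=> xS; have := wE x xS; apply: contra_eqN => /eqP->.
  by rewrite expr0n eq_sym mulf_neq0 // invr_eq0 node_poly_eq0 !inE eqxx.
exact (gap_code_NMDS nk cS w0 lam0 S0 wE IS cI I0).
Qed.

End FixedField.

(* The hypothesis 2 < n only excludes the case t = 1, l = 0, in which the
   conclusion fails by self_dual_length2_not_AMDS. *)
Theorem theorem3p6 (p m s l t q r n : nat) (F : finFieldType)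
    (p_prime : prime p) (p_odd : odd p)
    (m_gt0 : (0 < m)%N) (m_even : ~~ odd m)
    (q_def : q = (p ^ m)%N) (cardF : #|F| = q)
    (s_gt0 : (0 < s)%N) (s_dvd : (s %| m %/ 2)%N) (r_def : r = (p ^ s)%N)
    (l_lt : (l < m %/ s)%N) (t_gt0 : (0 < t)%N) (t_le : (t <= (r - 1) %/ 2)%N)
    (n_def : n = (2 * t * r ^ l)%N) (n_gt2 : (2 < n)%N) :
  exists C : {vspace 'rV[F]_n}, self_dual C /\ NMDS C.
Proof.
(* With m = 2es, q is r^(2e) and the bound on [l] is 2e. *)
have [e mE] := dvdnP s_dvd.
have m2 : m = (e.*2 * s)%N.
  by rewrite -(odd_double_half m) (negPf m_even) -divn2 mE -doubleMl.
apply: (@cosets_NMDS F p s e p_prime p_odd s_gt0 _ t l); rewrite -?r_def //.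
- by rewrite cardF q_def r_def -expnM m2 mulnC.
- by rewrite -subn1 -divn2.
- by rewrite m2 mulnK in l_lt.
Qed.
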